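(* Let $n>3$. The number of different representations of loops of order $2n$ which are right alternative and in which the square of each element is the identity is equal to the number of different proper edge colourings of the complete graph $K_{2n}$ using exactly $2n-1$ colours.
   Context: A loop is a set $L$ with a binary operation having a two-sided identity $e$ and such that for all $a,b\in L$ the equations $ax=b$ and $ya=b$ have unique solutions $x,y\in L$. A loop is right alternative if $(xy)y=x(yy)$ for all $x,y$. For a finite loop $(L,\bullet)$ and $\alpha\in L$ let $R_\alpha$ be the permutation $x\mapsto x\bullet\alpha$ of $L$; the set of permutations $\{R_\alpha : \alpha\in L\}$ is called the (right regular) representation of the loop. Representations are counted as sets of permutations of a fixed underlying set with $2n$ elements, over all loops of the stated kind on that set. A proper edge colouring assigns colours to edges so that no two adjacent edges have the same colour; the vertices of $K_{2n}$ are a fixed labelled set, and two colourings are counted as different when they give different partitions of the edge set into colour classes (so the names of the colours are irrelevant). *)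

(* Defs.v *)
From mathcomp Require Import all_boot all_fingroup.
From mathcomp Require Import boolp.

Set Implicit Arguments.
Unset Strict Implicit.
Unset Printing Implicit Defensive.

Record loop (T : Type) : Type := Loop {
  loop_op : T -> T -> T;
  loop_id : T;
  loop_idl : left_id loop_id loop_op;
  loop_idr : right_id loop_id loop_op;
  loop_ldiv : forall a b : T, exists! x : T, loop_op a x = b;
  loop_rdiv : forall a b : T, exists! y : T, loop_op y a = b
}.

Definition right_alternative (T : Type) (Q : loop T) : Prop :=
  forall x y : T,
    loop_op Q (loop_op Q x y) y = loop_op Q x (loop_op Q y y).

Definition squares_trivial (T : Type) (Q : loop T) : Prop :=
  forall x : T, loop_op Q x x = loop_id Q.

Lemma loop_op_injl (T : Type) (Q : loop T) (a : T) :
  injective (fun x : T => loop_op Q x a).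
Proof.
move=> x y /= eq_xy.
by have [z [_ zP]] := loop_rdiv Q a (loop_op Q y a); rewrite -(zP x) ?(zP y).
Qed.

Definition right_translation (L : finType) (Q : loop L) (a : L) : {perm L} :=
  perm (@loop_op_injl L Q a).

Definition representation (L : finType) (Q : loop L) : {set {perm L}} :=
  [set right_translation Q a | a : L].

(* The loops range over all loop structures on L, so the identity element is  *)
(* not fixed in advance.                                                      *)
Definition ra_squares_trivial_representations (L : finType) :
    {set {set {perm L}}} :=
  [set S : {set {perm L}} |
    `[< exists Q : loop L, [/\ right_alternative Q, squares_trivial Q
                             & S = representation Q] >]].

(* The edges of the complete graph on V are the 2-element subsets of V.       *)
Notation edge V := {e : {set V} | #|e| == 2}.

Definition adjacent (V : finType) (e f : edge V) : bool :=
  (e != f) && ~~ [disjoint val e & val f].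

Definition proper_edge_colouring (V : finType) (C : eqType)
    (c : edge V -> C) : bool :=
  [forall e : edge V, forall f : edge V, adjacent e f ==> (c e != c f)].

Definition uses_all_colours (V : finType) (C : finType)
    (c : edge V -> C) : bool :=
  [forall i : C, exists e : edge V, c e == i].

(* A colouring is identified with its partition of the edge set into colour   *)
(* classes, so that renaming the colours does not change it.                  *)
Definition edge_colourings (V : finType) (k : nat) : {set {set {set edge V}}} :=
  [set preim_partition c [set: edge V] | c : {ffun edge V -> 'I_k}
     & proper_edge_colouring c && uses_all_colours c].

(* Main.v *)
Require Import Defs.
From mathcomp Require Import all_boot all_fingroup.
From mathcomp Require Import boolp.

Set Implicit Arguments.
Unset Strict Implicit.
Unset Printing Implicit Defensive.

(** Both numbers count the 1-factorizations of a complete graph.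

    In a right alternative loop with trivial squares, (xy)y = x(yy) = x, so
    every right translation is an involution; the representation is a sharply
    transitive set of permutations because left division is unique, and it
    contains the identity.  Conversely a set S of involutions with these
    properties is the representation of a loop: fix any base point o and let
    the product of x and a be the image of x under the unique member of S that
    sends o to a.  Thus representations are exactly such sets
    ([ra_squares_trivial_representationsP]).

    On the other side, at each vertex of a complete graph on k + 1 vertices
    the k incident edges have distinct colours in a proper colouring, so with k
    colours each colour occurs exactly once at each vertex: the colour classes
    are perfect matchings.  Conversely a partition of the edges into perfect
    matchings has exactly k blocks, hence is such a colouring
    ([edge_colouringsP]).

    The two descriptions are matched by sending a set S to the family of
    matchings {x, s x}, one for each s in S other than the identity.  Such an s
    has no fixed point, since it would agree there with the identity; a
    fixed-point-free involution and a perfect matching determine each other;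
    and sharp transitivity of S says that each pair {a, b} with a <> b lies in
    exactly one of the matchings.  The two vertex sets are identified by an
    arbitrary bijection. *)

(** * Loop representations as sharply transitive sets of involutions *)

Record sharp_involutions (L : finType) (S : {set {perm L}}) : Prop := {
  sharp1 : 1%g \in S;
  sharpK : forall s, s \in S -> involutive s;
  sharp_trans : forall a b, exists2 s, s \in S & s a = b;
  sharp_inj : forall s t a, s \in S -> t \in S -> s a = t a -> s = t
}.

Lemma sharp_fpf (L : finType) (S : {set {perm L}}) (s : {perm L}) :
  sharp_involutions S -> s \in S -> s != 1%g -> forall x, s x != x.
Proof.
move=> shS sS s1 x; apply: contraNneq s1 => sx; apply/eqP.
by apply: (sharp_inj shS (a := x)) => //; [exact: sharp1 | rewrite perm1].
Qed.

Lemma representation_sharp (L : finType) (Q : loop L) :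
  right_alternative Q -> squares_trivial Q ->
  sharp_involutions (representation Q).
Proof.
move=> ra sq; split.
- apply/imsetP; exists (loop_id Q) => //; apply/permP => x.
  by rewrite perm1 permE loop_idr.
- by move=> _ /imsetP[a _ ->] x; rewrite !permE ra sq loop_idr.
- move=> a b; have [x [ax _]] := loop_ldiv Q a b.
  by exists (right_translation Q x); rewrite ?imset_f ?permE.
- move=> _ _ a /imsetP[x _ ->] /imsetP[y _ ->]; rewrite !permE => axy.
  have [z [_ zP]] := loop_ldiv Q a (loop_op Q a y).
  by rewrite -(zP x axy) (zP y erefl).
Qed.

(** The loop is read off from its prospective translations: [r a] is the member
    of [S] sending the base point [o] to [a], and it becomes the right
    translation by [a].  The base point, which is arbitrary, is the identity
    of the loop. *)
Lemma sharp_representation (L : finType) (o : L) (S : {set {perm L}}) :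
  sharp_involutions S ->
  exists Q : loop L,
    [/\ right_alternative Q, squares_trivial Q & S = representation Q].
Proof.
move=> shS.
have /fin_all_exists[r rP] (a : L) : exists s : {perm L}, s \in S /\ s o = a.
  by have [s sS so] := sharp_trans shS o a; exists s.
have rS a : r a \in S by case: (rP a).
have ro a : r a o = a by case: (rP a).
have rE s : s \in S -> r (s o) = s.
  by move=> sS; apply: (sharp_inj shS (a := o)); rewrite ?ro.
have rK a : involutive (r a) := sharpK shS (rS a).
have r_id : r o = 1%g by rewrite -[o in LHS](perm1 o) rE ?(sharp1 shS).
have ldiv a b : exists! x, r x a = b.
  (* The member of S sending a to b is the translation by its value at o. *)
  have [s sS sab] := sharp_trans shS a b; exists (s o); split.
    by rewrite rE.
  move=> x xab; rewrite (_ : s = r x) ?ro //.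
  by apply: (sharp_inj shS (a := a)); rewrite ?sab.
have rdiv a b : exists! y, r a y = b.
  by exists (r a b); split=> [|y <-]; rewrite rK.
have id_r : right_id o (fun x a => r a x) by move=> x; rewrite r_id perm1.
pose Q := Loop ro id_r ldiv rdiv.
have sq : squares_trivial Q by move=> x /=; rewrite -[X in r x X]ro rK.
exists Q; split=> //.
- by move=> x y; rewrite sq /= rK r_id perm1.
have rtE a : right_translation Q a = r a by apply/permP=> x; rewrite permE.
apply/setP => s; apply/idP/imsetP => [sS | [a _ ->]]; last by rewrite rtE.
by exists (s o); rewrite // rtE rE.
Qed.

Lemma ra_squares_trivial_representationsP (L : finType) (S : {set {perm L}}) :
  0 < #|L| ->
  S \in ra_squares_trivial_representations L <-> sharp_involutions S.
Proof.
move=> /card_gt0P[o _]; rewrite inE; split.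
  by move=> /asboolP[Q [ra sq ->]]; apply: representation_sharp.
by move=> /(sharp_representation o) ?; apply/asboolP.
Qed.

(** * Edge colourings as 1-factorizations *)

Section OneFactorizations.

Variable V : finType.
Implicit Types (e : edge V) (M : {set edge V}) (P : {set {set edge V}}).

Record perfect_matching M : Prop := {
  matching_cover : forall v, exists2 e, e \in M & v \in val e;
  matching_inj : forall e e' v,
    e \in M -> e' \in M -> v \in val e -> v \in val e' -> e = e'
}.

Definition one_factorization P : Prop :=
  partition P [set: edge V] /\ forall M, M \in P -> perfect_matching M.

Definition star (v : V) : {set edge V} := [set e : edge V | v \in val e].

Lemma edge_between (u v : V) : u != v -> exists e : edge V, val e = [set u; v].
Proof.
move=> uv; have c2 : #|[set u; v]| == 2 by rewrite cards2 uv.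
by exists (exist _ [set u; v] c2).
Qed.

Lemma edgeE e u v : u != v -> u \in val e -> v \in val e -> val e = [set u; v].
Proof.
move=> uv ue ve; apply/esym/eqP; rewrite eqEcard subUset !sub1set ue ve.
by rewrite cards2 uv (eqP (valP e)).
Qed.

Lemma edge_other_end e u : u \in val e -> exists2 v, v != u & v \in val e.
Proof.
move=> ue; have /card_gt0P[v] : 0 < #|val e :\ u|.
  by have := cardsD1 u (val e); rewrite (eqP (valP e)) ue; case: #|_|.
by rewrite !inE => /andP[vu ve]; exists v.
Qed.

Lemma card_star v : #|star v| = #|V|.-1.
Proof.
rewrite -(cardsC1 v) -(card_imset _ val_inj).
rewrite -(card_in_imset (f := fun w => [set v; w])) => [|w w']; last first.
  rewrite !inE => wv _ /setP/(_ w).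
  by rewrite !inE eqxx orbT (negPf wv) => /esym/eqP.
apply: eq_card => A; apply/imsetP/imsetP => -[].
  move=> e; rewrite inE => ve ->; have [w wv we] := edge_other_end ve.
  by exists w; rewrite ?inE ?(edgeE _ ve we) // eq_sym.
move=> w; rewrite !inE eq_sym => /edge_between[e ve] ->.
by exists e; rewrite // inE ve !inE eqxx.
Qed.

Lemma proper_on_star (C : eqType) (c : edge V -> C) v :
  proper_edge_colouring c -> {in star v &, injective c}.
Proof.
move=> /forallP pc e e'; rewrite !inE => ve ve' cee'.
apply: contraTeq isT => ee'; have /forallP/(_ e')/implyP := pc e.
rewrite cee' eqxx => -> //; rewrite /adjacent ee' /=.
by apply/pred0Pn; exists v; rewrite /= ve ve'.
Qed.

(** A proper colouring is injective on the edges at a vertex; there are as many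
    of these as colours, so every colour occurs at every vertex. *)
Lemma colouring_one_factorization k (c : edge V -> 'I_k) :
  #|V| = k.+1 -> proper_edge_colouring c ->
  one_factorization (preim_partition c [set: edge V]).
Proof.
move=> cV pc; split; first exact: preim_partitionP.
move=> _ /imsetP[e0 _ ->]; split.
  move=> v; have : c e0 \in c @: star v.
    suff -> : c @: star v = [set: 'I_k] by rewrite inE.
    apply/eqP; rewrite eqEcard subsetT cardsT card_ord.
    by rewrite card_in_imset ?card_star ?cV /=; last exact: proper_on_star.
  move=> /imsetP[e]; rewrite inE => ve ce.
  by exists e; rewrite // !inE ce eqxx.
move=> e e' v; rewrite !inE /= => /eqP ce /eqP ce' ve ve'.
by apply: (proper_on_star pc (v := v)); rewrite ?inE // -ce.
Qed.

(** Each matching contains exactly one edge at a given vertex, so the map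
    sending an edge to its block is a bijection from the edges at that vertex
    to the blocks. *)
Lemma card_one_factorization P : one_factorization P -> 0 < #|V| ->
  #|P| = #|V|.-1.
Proof.
move=> [partP pmP] /card_gt0P[v _]; rewrite -(card_star v).
have /and3P[/eqP covP trivP _] := partP.
have inP e : pblock P e \in P by rewrite pblock_mem // covP inE.
have inb e : e \in pblock P e by rewrite mem_pblock covP inE.
rewrite -(card_in_imset (f := pblock P) (D := mem (star v))).
  apply: eq_card => M; apply/idP/imsetP => [MP | [e _ ->] //].
  have [e eM ve] := matching_cover (pmP M MP) v.
  by exists e; rewrite ?inE //; apply/esym/def_pblock.
move=> e e'; rewrite !inE => ve ve' bee'.
apply: (matching_inj (pmP _ (inP e)) (v := v)) => //.
by rewrite bee'.
Qed.

(** An edge is coloured by the rank of its block among the blocks, of which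
    there are exactly [k]. *)
Lemma one_factorization_colouring k P : #|V| = k.+1 ->
  one_factorization P -> P \in edge_colourings V k.
Proof.
move=> cV ofP; have [partP pmP] := ofP.
have /and3P[/eqP covP trivP P0] := partP.
have inP e : pblock P e \in P by rewrite pblock_mem // covP inE.
have inb e : e \in pblock P e by rewrite mem_pblock covP inE.
have cP : #|P| = k by rewrite card_one_factorization // cV.
pose c := [ffun e => cast_ord cP (enum_rank_in (inP e) (pblock P e))].
(* The value of enum_rank_in does not depend on its membership proof, which *)
(* differs from one edge to the other.                                      *)
have cE e M (MP : M \in P) :
    c e = cast_ord cP (enum_rank_in MP M) -> pblock P e = M.
  rewrite ffunE => /cast_ord_inj/(congr1 enum_val).
  by rewrite !enum_rankK_in.
have c_inj e e' : c e = c e' -> pblock P e = pblock P e'.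
  by rewrite [c e']ffunE; apply: cE.
have c_block e e' : pblock P e = pblock P e' -> c e = c e'.
  move=> bee'; rewrite !ffunE; congr cast_ord; apply: enum_val_inj.
  by rewrite !enum_rankK_in.
apply/imsetP; exists c; first rewrite inE; last first.
  rewrite -[LHS](preim_partition_pblock partP).
  apply: eq_imset => e; apply/setP => e'; rewrite !inE /=.
  by apply/eqP/eqP => [/c_block | /c_inj].
apply/andP; split.
  apply/forallP => e; apply/forallP => e'; apply/implyP => /andP[ee'].
  case/pred0Pn => v /andP[/= ve ve']; apply: contra_neq ee' => /c_inj bee'.
  by apply: (matching_inj (pmP _ (inP e)) (v := v)); rewrite // bee'.
apply/forallP => i; have MP := enum_valP (cast_ord (esym cP) i).
move: MP; set M := enum_val _ => MP.
have /set0Pn[e eM] : M != set0 by apply: contraNneq P0 => <-.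
apply/existsP; exists e; rewrite ffunE -(inj_eq (@cast_ord_inj _ _ (esym cP))).
rewrite cast_ordK; apply/eqP/enum_val_inj; rewrite enum_rankK_in //.
exact: def_pblock.
Qed.

Lemma edge_colouringsP k P : #|V| = k.+1 ->
  P \in edge_colourings V k <-> one_factorization P.
Proof.
move=> cV; split; last exact: one_factorization_colouring.
case/imsetP => c; rewrite inE => /andP[pc _] ->.
exact: colouring_one_factorization.
Qed.

End OneFactorizations.

(** * Involutions and perfect matchings *)

Section Correspondence.

Variables (L V : finType) (f : L -> V).
Hypothesis f_bij : bijective f.
Implicit Types (s t : {perm L}) (S : {set {perm L}}).

Let f_inj : injective f := bij_inj f_bij.

(** For a fixed-point-free involution [s] these are the edges
    {f x, f (s x)}; see [swapped_edgesP].  Expressing them by stability avoids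
    building elements of the subtype of edges. *)
Definition swapped_edges s : {set edge V} :=
  [set e : edge V | [forall x, (f x \in val e) ==> (f (s x) \in val e)]].

Definition fpf_involution s : Prop := involutive s /\ forall x, s x != x.

Definition factorization S : {set {set edge V}} :=
  [set swapped_edges s | s in S :\ 1%g].

Lemma swapped_edgesP s (e : edge V) x : fpf_involution s -> f x \in val e ->
  e \in swapped_edges s <-> val e = [set f x; f (s x)].
Proof.
move=> [sK sx] xe; rewrite inE; split.
  move=> /forallP/(_ x)/implyP/(_ xe); apply: edgeE => //.
  by rewrite (inj_eq f_inj) eq_sym.
move=> eE; apply/forallP => y; apply/implyP.
by rewrite eE !inE !(inj_eq f_inj) => /orP[]/eqP ->; rewrite ?sK eqxx ?orbT.
Qed.

Lemma swapped_edges_val s (e : edge V) x :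
  fpf_involution s -> val e = [set f x; f (s x)] -> e \in swapped_edges s.
Proof.
by move=> fs eE; apply/(swapped_edgesP (x := x)); rewrite // eE !inE eqxx.
Qed.

Lemma swapped_edge s x : fpf_involution s ->
  exists2 e : edge V, e \in swapped_edges s & val e = [set f x; f (s x)].
Proof.
move=> fs; have := fs.2 x; rewrite eq_sym -(inj_eq f_inj) => /edge_between[e eE].
by exists e => //; apply: swapped_edges_val eE.
Qed.

Lemma swapped_edges_eval s t (e : edge V) x :
    fpf_involution s -> fpf_involution t -> f x \in val e ->
  e \in swapped_edges s -> e \in swapped_edges t -> s x = t x.
Proof.
move=> fs ft xe /(swapped_edgesP fs xe) eE /(swapped_edgesP ft xe).
rewrite eE => /setP/(_ (f (s x))); rewrite !inE eqxx orbT !(inj_eq f_inj).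
by rewrite (negPf (fs.2 x)) => /esym/eqP.
Qed.

Lemma swapped_edges_inj s t : fpf_involution s -> fpf_involution t ->
  swapped_edges s = swapped_edges t -> s = t.
Proof.
move=> fs ft st; apply/permP => x; have [e es eE] := swapped_edge x fs.
by apply: (@swapped_edges_eval s t e); rewrite -?st // eE !inE eqxx.
Qed.

Lemma swapped_edges_matching s :
  fpf_involution s -> perfect_matching (swapped_edges s).
Proof.
have [g _ gK] := f_bij => fs; split=> [v | e e' v].
  have [e es eE] := swapped_edge (g v) fs.
  by exists e; rewrite // eE !inE gK eqxx.
rewrite -(gK v) => es es' ve ve'; apply: val_inj.
by rewrite (iffLR (swapped_edgesP fs ve) es) (iffLR (swapped_edgesP fs ve') es').
Qed.

(** The involution exchanges the two ends of each edge of the matching. *)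
Lemma matching_swapped_edges (M : {set edge V}) : perfect_matching M ->
  exists2 s, fpf_involution s & swapped_edges s = M.
Proof.
move=> pM; have [g fK gK] := f_bij.
have /fin_all_exists[h hP] (x : L) : exists y : L, y != x /\
    exists2 e : edge V, e \in M & val e = [set f x; f y].
  have [e eM xe] := matching_cover pM (f x).
  have [v vx ve] := edge_other_end xe; exists (g v).
  rewrite -(inj_eq f_inj) gK; split=> //; exists e => //.
  by rewrite (edgeE _ xe ve) // eq_sym.
have hx x : h x != x by case: (hP x).
have hK : involutive h.
  move=> x; have [_ [e eM eE]] := hP x; have [_ [e' eM' eE']] := hP (h x).
  have ee' : e = e'.
    apply: (matching_inj pM (v := f (h x))) => //.
      by rewrite eE !inE eqxx orbT.
    by rewrite eE' !inE eqxx.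
  have : f x \in val e' by rewrite -ee' eE !inE eqxx.
  rewrite eE' !inE !(inj_eq f_inj) eq_sym (negPf (hx x)) /=.
  by move/eqP.
pose s := perm (inv_inj hK).
have sE x : s x = h x by rewrite permE.
have fs : fpf_involution s by split=> x; rewrite !sE ?hK.
exists s => //.
(* Both sides are perfect matchings, and they share an edge at each vertex. *)
have pS := swapped_edges_matching fs.
apply/setP => e; have /card_gt0P[v ve] : 0 < #|val e| by rewrite (eqP (valP e)).
rewrite -(gK v) in ve; have [_ [e' eM' eE']] := hP (g v).
have es' : e' \in swapped_edges s.
  by apply: (swapped_edges_val (x := g v)); rewrite ?sE.
have ve' : f (g v) \in val e' by rewrite eE' !inE eqxx.
by apply/idP/idP => ?; [rewrite (matching_inj pS _ es' ve ve')
                       | rewrite (matching_inj pM _ eM' ve ve')].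
Qed.

Lemma sharp_fpf_involution S s :
  sharp_involutions S -> s \in S :\ 1%g -> fpf_involution s.
Proof.
move=> shS; rewrite !inE => /andP[s1 sS].
by split; [exact: (sharpK shS) | exact: sharp_fpf shS sS s1].
Qed.

(** A member of one set other than the identity has the same matching as some
    member of the other, and the matching determines the involution. *)
Lemma factorization_inj S T :
    sharp_involutions S -> sharp_involutions T ->
  factorization S = factorization T -> S = T.
Proof.
have sub S1 T1 : sharp_involutions S1 -> sharp_involutions T1 ->
    factorization S1 = factorization T1 -> S1 \subset T1.
  move=> shS shT ST; apply/subsetP => s sS.
  have [-> | s1] := eqVneq s 1%g; first exact: sharp1.
  have sS1 : s \in S1 :\ 1%g by rewrite !inE s1.
  have : swapped_edges s \in factorization T1 by rewrite -ST imset_f.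
  case/imsetP => t tT1 /swapped_edges_inj -> //.
  - by move: tT1; rewrite !inE => /andP[].
  - exact: sharp_fpf_involution sS1.
  - exact: sharp_fpf_involution tT1.
by move=> shS shT ST; apply/eqP; rewrite eqEsubset !sub.
Qed.

(** Transitivity makes the matchings cover all edges; sharpness makes them
    disjoint. *)
Lemma factorization_one_factorization S : 0 < #|L| ->
  sharp_involutions S -> one_factorization (factorization S).
Proof.
have [g fK gK] := f_bij; move=> /card_gt0P[o _] shS.
have fpfS s : s \in S :\ 1%g -> fpf_involution s by exact: sharp_fpf_involution.
split; last by move=> _ /imsetP[s sS ->]; apply/swapped_edges_matching/fpfS.
apply/and3P; split.
- rewrite eqEsubset subsetT; apply/subsetP => e _.
  have /card_gt0P[v ve] : 0 < #|val e| by rewrite (eqP (valP e)).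
  have [w wv we] := edge_other_end ve.
  have [s sS sE] := sharp_trans shS (g v) (g w).
  have s1 : s != 1%g.
    by apply: contraNneq wv => s1; rewrite -(can_eq gK) -sE s1 perm1.
  have sS1 : s \in S :\ 1%g by rewrite !inE s1.
  apply/bigcupP; exists (swapped_edges s); first exact: imset_f.
  apply: (swapped_edges_val (x := g v)); first exact: fpfS.
  by rewrite sE !gK (edgeE _ ve we) // eq_sym.
- apply/trivIsetP => _ _ /imsetP[s sS ->] /imsetP[t tS ->].
  apply: contraR => /pred0Pn[e /andP[/= es et]].
  have /card_gt0P[v ve] : 0 < #|val e| by rewrite (eqP (valP e)).
  rewrite -(gK v) in ve.
  have st := swapped_edges_eval (fpfS _ sS) (fpfS _ tS) ve es et.
  move: sS tS; rewrite !inE => /andP[_ sS] /andP[_ tS].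
  by rewrite (sharp_inj shS sS tS st).
- apply/imsetP => -[s /fpfS fs s0].
  by have [e] := swapped_edge o fs; rewrite -s0 inE.
Qed.

(** The preimage consists of the identity and of the involutions of all the
    matchings: the edge between two points lies in exactly one block, which
    gives transitivity and sharpness at these points. *)
Lemma one_factorizationP (P : {set {set edge V}}) : one_factorization P ->
  exists2 S, sharp_involutions S & P = factorization S.
Proof.
move=> [partP pmP]; have [g fK gK] := f_bij.
have /and3P[/eqP covP trivP _] := partP.
pose S := [set s : {perm L} |
  (s == 1%g) || `[< fpf_involution s /\ swapped_edges s \in P >]].
have SP s : s \in S -> s = 1%g \/ fpf_involution s /\ swapped_edges s \in P.
  by rewrite inE => /orP[/eqP | /asboolP]; [left | right].
have S1 : 1%g \in S by rewrite inE eqxx.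
have inS s : fpf_involution s -> swapped_edges s \in P -> s \in S.
  by move=> fs sP; rewrite inE; apply/orP; right; apply/asboolP.
have fpfn1 s : fpf_involution s -> 0 < #|L| -> s != 1%g.
  move=> fs /card_gt0P[x _].
  by apply: contraNneq (fs.2 x) => ->; rewrite perm1.
exists S; first split=> //.
- by move=> s /SP[-> | [[]]] // x; rewrite !perm1.
- move=> a b; have [<- | ab] := eqVneq a b.
    by exists 1%g; rewrite ?perm1.
  have [e eE] : exists e : edge V, val e = [set f a; f b].
    by apply: edge_between; rewrite (inj_eq f_inj).
  have : e \in cover P by rewrite covP inE.
  case/bigcupP => M MP eM.
  have [s fs sM] := matching_swapped_edges (pmP M MP).
  exists s; first by apply: inS; rewrite ?sM.
  have ae : f a \in val e by rewrite eE !inE eqxx.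
  move: eM; rewrite -sM => /(swapped_edgesP fs ae); rewrite eE => /setP/(_ (f b)).
  by rewrite !inE eqxx orbT !(inj_eq f_inj) eq_sym (negPf ab) => /esym/eqP.
- move=> s t a /SP[-> | [fs sP]] /SP[-> | [ft tP]] //.
  + by move/eqP; rewrite perm1 eq_sym (negPf (ft.2 a)).
  + by move/eqP; rewrite perm1 (negPf (fs.2 a)).
  move=> sta; apply: swapped_edges_inj => //.
  have [e es eE] := swapped_edge a fs.
  have et : e \in swapped_edges t.
    by apply: (swapped_edges_val (x := a)); rewrite -?sta.
  by rewrite -(def_pblock trivP sP es) (def_pblock trivP tP et).
apply/setP => M; apply/idP/imsetP => [MP | [s]].
  have [s fs sM] := matching_swapped_edges (pmP M MP).
  exists s => //; rewrite in_setD1 inS ?sM // fpfn1 //.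
  have /and3P[_ _ P0] := partP.
  have /set0Pn[e _] : M != set0 by apply: contraNneq P0 => <-.
  have /card_gt0P[v _] : 0 < #|val e| by rewrite (eqP (valP e)).
  by apply/card_gt0P; exists (g v).
rewrite in_setD1 => /andP[s1 /SP[s1' | [_ sP] -> //]].
by rewrite s1' eqxx in s1.
Qed.

End Correspondence.

(** * The two counts agree *)

Theorem mainTheorem1 (n : nat) (L V : finType) (hn : 3 < n)
    (hL : #|L| = 2 * n) (hV : #|V| = 2 * n) :
  #|ra_squares_trivial_representations L| = #|edge_colourings V (2 * n - 1)|.
Proof.
have L0 : 0 < #|L| by rewrite hL muln_gt0 (ltn_trans _ hn).
have cV : #|V| = (2 * n - 1).+1 by rewrite hV subn1 prednK // -hL.
have [f f_bij] : exists f : L -> V, bijective f.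
  have LV : #|L| = #|V| by rewrite hL hV.
  exists (fun x => enum_val (cast_ord LV (enum_rank x))).
  apply: inj_card_bij; last by rewrite LV.
  by move=> x y /enum_val_inj/cast_ord_inj/enum_rank_inj.
rewrite -(card_in_imset (f := factorization f)
            (D := mem (ra_squares_trivial_representations L))).
  apply: eq_card => P; apply/imsetP/idP => [[S] | ].
    move=> /(ra_squares_trivial_representationsP _ L0) shS ->.
    by apply/edge_colouringsP => //; apply: factorization_one_factorization.
  move=> /(edge_colouringsP _ cV)/(one_factorizationP f_bij)[S shS ->].
  by exists S => //; apply/ra_squares_trivial_representationsP.
move=> S T /(ra_squares_trivial_representationsP _ L0) shS.
move=> /(ra_squares_trivial_representationsP _ L0) shT.
exact: factorization_inj.
Qed.
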